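(* Let $K\ge 2$, $\epsilon\in(0,\tfrac12)$, and let $S:\mathcal X\times[K]\to\mathbb{R}$ be a score function. Let $(X,Y)$ be a clean pair with $Y\in[K]$, and let the observed label $\tilde Y$ equal $Y$ with probability $1-\epsilon$ and a draw $Y^c$ from a corrupting distribution on $[K]$ with probability $\epsilon$, with $\tilde Y$ conditionally independent of $X$ given $Y$. Let $P_i=\mathbb{P}(Y=i)$, $\tilde P_i=\mathbb{P}(\tilde Y=i)>0$, and let $P\in\mathbb{R}^{K\times K}$ with $P_{ji}=\mathbb{P}(Y=j\mid\tilde Y=i)$ be invertible, with inverse entries $P^{-1}_{ji}$. Define $F_1(q)=\mathbb{P}(S(X,Y)\le q)$, $\tilde F(q)=\mathbb{P}(S(X,\tilde Y)\le q)$, $g(q)=F_1(q)-\tilde F(q)$, and $\tilde F(q;i,j)=\mathbb{P}(S(X,i)\le q\mid\tilde Y=j)$. Given i.i.d. calibration data $(X_\ell,\tilde Y_\ell)$, $\ell=1,\dots,n$, distributed as $(X,\tilde Y)$, let $$\tilde F_n(q;i,j)=\frac{\sum_{\ell=1}^n\mathbf 1(S(X_\ell,i)\le q)\mathbf 1(\tilde Y_\ell=j)}{\sum_{\ell=1}^n\mathbf 1(\tilde Y_\ell=j)}\quad(0/0:=0),$$ $$\hat g(q)=\sum_{i=1}^K\sum_{j=1}^K P_iP^{-1}_{ji}\tilde F_n(q;i,j)-\sum_{i=1}^K\tilde P_i\tilde F_n(q;i,i).$$ Set $w^{(1)}_i=P^{-1}_{ii}P_i-\tilde P_i$, $w^{(2)}_{ij}=P_iP^{-1}_{ji}$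 and $b(n,j)=(1-\tilde P_j)^n+\sqrt{\frac{\pi}{n\tilde P_j}}$. Then for any $k\in[n]$, with $S_{(k)}$ the $k$-th order statistic of the calibration scores $S(X_\ell,\tilde Y_\ell)$, $$\mathbb{E}\big[|\hat g(S_{(k)})-g(S_{(k)})|\big]\le B(n,\epsilon):=\sum_{i=1}^K\Big(|w^{(1)}_i|\,b(n,i)+\sum_{j\ne i}|w^{(2)}_{ij}|\,b(n,j)\Big).$$
   Context: $[K]=\{1,\dots,K\}$. All probabilities are with respect to the joint distribution described; the calibration pairs are independent. *)

(* Defs.v *)
From HB Require Import structures.
From mathcomp Require Import all_boot all_order all_algebra.
From mathcomp Require Import all_classical all_reals all_analysis.
Unset Printing Implicit Defensive.
Import Order.TTheory GRing.Theory Num.Theory.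
Local Open Scope classical_set_scope.
Local Open Scope ring_scope.

Section noisy_conformal.
Context {R : realType} {d : measure_display} {T : measurableType d}
  (P : probability T R).

Definition pr (A : set T) : R := fine (P A).

Definition cpr (A B : set T) : R := pr (A `&` B) / pr B.

Context {dX : measure_display} {X : measurableType dX} {K : nat}.

(* Ytilde = Y if the (epsilon-)coin Bn is false, else the corrupted draw Yc *)
Definition noisy_label (Y Yc : T -> 'I_K) (Bn : T -> bool) : T -> 'I_K :=
  fun w => if Bn w then Yc w else Y w.

Definition Pmarg (Y : T -> 'I_K) (i : 'I_K) : R := pr [set w | Y w = i].

Definition Pcond (Y Yt : T -> 'I_K) : 'M[R]_K :=
  \matrix_(j, i) cpr [set w | Y w = j] [set w | Yt w = i].

Definition cdf_score (S : X -> 'I_K -> R) (X0 : T -> X) (Y0 : T -> 'I_K) (q : R) : R :=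
  pr [set w | S (X0 w) (Y0 w) <= q].

Definition gfun S X0 (Y Yt : T -> 'I_K) (q : R) : R :=
  cdf_score S X0 Y q - cdf_score S X0 Yt q.

Definition cond_indep_label (X0 : T -> X) (Y Yt : T -> 'I_K) : Prop :=
  forall (A : set X) (i j : 'I_K), measurable A ->
    pr [set w | A (X0 w) /\ Yt w = j /\ Y w = i] * pr [set w | Y w = i]
    = pr [set w | A (X0 w) /\ Y w = i] * pr [set w | Yt w = j /\ Y w = i].

Definition coin_indep (X0 : T -> X) (Y Yc : T -> 'I_K) (Bn : T -> bool) : Prop :=
  forall (A : set X) (C D : set 'I_K) (b : bool), measurable A ->
    pr [set w | A (X0 w) /\ C (Y w) /\ D (Yc w) /\ Bn w = b]
    = pr [set w | A (X0 w) /\ C (Y w) /\ D (Yc w)] * pr [set w | Bn w = b].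

Definition iid_pairs_as (n : nat) (Xs : 'I_n -> T -> X) (Ys : 'I_n -> T -> 'I_K)
  (X0 : T -> X) (Yt : T -> 'I_K) : Prop :=
  (forall (A : 'I_n -> set X) (B : 'I_n -> set 'I_K),
      (forall l, measurable (A l)) ->
      pr (\bigcap_(l in [set: 'I_n]) [set w | A l (Xs l w) /\ B l (Ys l w)])
      = \prod_(l < n) pr [set w | A l (Xs l w) /\ B l (Ys l w)])
  /\ (forall (l : 'I_n) (A : set X) (j : 'I_K), measurable A ->
      pr [set w | A (Xs l w) /\ Ys l w = j] = pr [set w | A (X0 w) /\ Yt w = j]).

(* empirical conditional cdf  Ftilde_n(q; i, j)  (0/0 := 0, as x / 0 = 0) *)
Definition Fn (n : nat) (S : X -> 'I_K -> R) (Xs : 'I_n -> T -> X)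
  (Ys : 'I_n -> T -> 'I_K) (w : T) (q : R) (i j : 'I_K) : R :=
  (\sum_(l < n) ((S (Xs l w) i <= q) && (Ys l w == j))%:R)
  / (\sum_(l < n) (Ys l w == j)%:R).

Definition ghat (n : nat) S (Y Yt : T -> 'I_K) Xs Ys (w : T) (q : R) : R :=
  \sum_(i < K) \sum_(j < K)
     Pmarg Y i * (invmx (Pcond Y Yt)) j i * Fn n S Xs Ys w q i j
  - \sum_(i < K) Pmarg Yt i * Fn n S Xs Ys w q i i.

(* the k-th order statistic (k in 1..size s) *)
Definition order_stat (s : seq R) (k : nat) : R := nth 0 (sort <=%R s) k.-1.

Definition calib_scores (n : nat) (S : X -> 'I_K -> R) Xs Ys (w : T) : seq R :=
  [seq S (Xs l w) (Ys l w) | l <- enum 'I_n].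

Definition bfun (Yt : T -> 'I_K) (n : nat) (j : 'I_K) : R :=
  (1 - Pmarg Yt j) ^+ n + Num.sqrt (pi / (n%:R * Pmarg Yt j)).

Definition Bbound (Y Yt : T -> 'I_K) (n : nat) : R :=
  \sum_(i < K)
    (`|(invmx (Pcond Y Yt)) i i * Pmarg Y i - Pmarg Yt i| * bfun Yt n i
     + \sum_(j < K | j != i)
         `|Pmarg Y i * (invmx (Pcond Y Yt)) j i| * bfun Yt n j).

End noisy_conformal.

(* Main.v *)
Require Import Defs.
From HB Require Import structures.
From mathcomp Require Import all_boot all_order all_algebra.
From mathcomp Require Import fingroup perm.
From mathcomp Require Import all_classical all_reals all_analysis.
From mathcomp Require Import measurable_realfun zify ring lra.
Set Implicit Arguments.
Unset Strict Implicit.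
Import Order.TTheory GRing.Theory Num.Theory.
Local Open Scope classical_set_scope.
Local Open Scope ring_scope.

(** Since [F(q; i, .)] is the row of the [P(S(X, i) <= q | Y = l)] times the
    matrix [P], inverting [P] writes [ghat - g] as a combination, with the
    weights of [Bbound], of the deviations [D_ij = |F_n(q; i, j) - F(q; i, j)|],
    and the random [q] is handled by bounding [E sup_q D_ij].

    Let [N] be the number of calibration labels equal to [j].  The sharp DKW
    inequality is not needed, because [E (sup D)^2 <= 2 / (m + 1)] given
    [N = m >= 1] has an elementary proof.  By Jensen's inequality the true cdf
    may be replaced by the empirical cdf of a ghost sample of size [m]; by
    exchangeability, the deviation is then at most [1 / m] times the maximum
    [M] of the absolute value of a uniform random bridge with [m] steps up and
    [m] steps down.  The reflection principle gives
    [P(M >= h) <= 2 'C(2m, m + h) / 'C(2m, m)], and [2 h 'C(2m, m + h)]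
    telescopes, so that [E M^2 <= 2m - 2m / (m + 1)].  Finally
    [E[2 / (N + 1)] <= 2 / ((n + 1) p) <= pi / (n p)] with [p = P(Yt = j)], and
    the event [N = 0] contributes [(1 - p)^n].

    Everything probabilistic is done for the maximum over a finite set of
    thresholds, where the sample falls in finitely many cells; rational
    thresholds, right continuity and monotone convergence give all [q]. *)

(** * Iterated sums *)

Section IteratedSums.
Context {R : realFieldType}.

(* The sum of [f] against the [n]-fold product of the masses [mu], whose total
   need not be 1. *)
Fixpoint Ex (Z : finType) (mu : Z -> R) (n : nat) (f : seq Z -> R) : R :=
  if n is m.+1 then \sum_z mu z * Ex mu m (fun s => f (z :: s)) else f [::].

Lemma eq_Ex (Z : finType) (mu : Z -> R) n f g :
  (forall s, size s = n -> f s = g s) -> Ex mu n f = Ex mu n g.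
Proof.
elim: n f g => [|n IH] f g fg /=; first exact: fg.
by apply: eq_bigr => z _; congr (_ * _); apply: IH => s ss; apply: fg; rewrite /= ss.
Qed.

Lemma le_Ex (Z : finType) (mu : Z -> R) n f g : (forall z, 0 <= mu z) ->
  (forall s, size s = n -> f s <= g s) -> Ex mu n f <= Ex mu n g.
Proof.
move=> mu0; elim: n f g => [|n IH] f g fg /=; first exact: fg.
apply: ler_sum => z _; apply: ler_wpM2l => //.
by apply: IH => s ss; apply: fg; rewrite /= ss.
Qed.

Lemma Ex_ge0 (Z : finType) (mu : Z -> R) n f : (forall z, 0 <= mu z) ->
  (forall s, 0 <= f s) -> 0 <= Ex mu n f.
Proof.
move=> mu0; elim: n f => [|n IH] f f0 /=; first exact: f0.
by apply: sumr_ge0 => z _; apply: mulr_ge0 => //; exact: IH.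
Qed.

Lemma Ex_sum (Z : finType) (mu : Z -> R) n (I : finType) (c : I -> R)
    (f : I -> seq Z -> R) :
  Ex mu n (fun s => \sum_i c i * f i s) = \sum_i c i * Ex mu n (f i).
Proof.
elim: n f => [|n IH] f //=.
under eq_bigr => z _ do rewrite IH mulr_sumr.
rewrite exchange_big /=; apply: eq_bigr => i _.
by rewrite mulr_sumr; apply: eq_bigr => z _; rewrite mulrCA.
Qed.

Lemma ExM (Z : finType) (mu : Z -> R) n c f :
  Ex mu n (fun s => c * f s) = c * Ex mu n f.
Proof.
elim: n f => [|n IH] f //=; rewrite mulr_sumr; apply: eq_bigr => z _.
by rewrite IH mulrCA.
Qed.

Lemma ExD (Z : finType) (mu : Z -> R) n f g :
  Ex mu n (fun s => f s + g s) = Ex mu n f + Ex mu n g.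
Proof.
elim: n f g => [|n IH] f g //=; rewrite -big_split; apply: eq_bigr => z _ /=.
by rewrite IH mulrDr.
Qed.

Lemma Ex_cst (Z : finType) (mu : Z -> R) n c :
  Ex mu n (fun=> c) = (\sum_z mu z) ^+ n * c.
Proof.
elim: n => [|n IH] /=; first by rewrite mul1r.
by under eq_bigr => z _ do rewrite IH; rewrite -mulr_suml exprS mulrA.
Qed.

Lemma Ex_exchange (Z W : finType) (mu : Z -> R) (nu : W -> R) n m f :
  Ex mu n (fun s => Ex nu m (fun t => f s t)) =
  Ex nu m (fun t => Ex mu n (fun s => f s t)).
Proof.
elim: n f => [|n IH] f //=.
by rewrite Ex_sum; apply: eq_bigr => z _; rewrite IH.
Qed.

Lemma Ex_scale (Z : finType) (mu : Z -> R) c n f :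
  Ex (fun z => c * mu z) n f = c ^+ n * Ex mu n f.
Proof.
elim: n f => [|n IH] f /=; first by rewrite mul1r.
rewrite mulr_sumr; apply: eq_bigr => z _; rewrite IH exprS; ring.
Qed.

(** The non-recursive form, needed where positions are permuted and where the law of the calibration
    sample is substituted. The reindexing splits a tuple into head and tail. *)
Lemma Ex_tuple (Z : finType) (mu : Z -> R) n f :
  Ex mu n f = \sum_(v : n.-tuple Z) (\prod_(i < n) mu (tnth v i)) * f v.
Proof.
elim: n f => [|n IH] f.
  rewrite (bigD1 [tuple]) //= big_ord0 mul1r big1 ?addr0 // => v.
  by rewrite tuple0.
rewrite /=; under eq_bigr => z _ do rewrite IH mulr_sumr.
rewrite pair_big /=.
rewrite [RHS](reindex (fun u : Z * n.-tuple Z => [tuple of u.1 :: u.2])) /=.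
  apply: eq_bigr => -[z v] _ /=; rewrite big_ord_recl tnth0 mulrA.
  by congr (_ * _ * _); apply: eq_bigr => i _; rewrite tnthS.
exists (fun v : n.+1.-tuple Z => (thead v, [tuple of behead v])).
  by move=> [z v] _ /=; rewrite theadE; congr (_, _); apply: val_inj.
by move=> v _; rewrite /= [RHS]tuple_eta.
Qed.

Lemma Ex_count (Z : finType) (mu : Z -> R) n (a : pred Z) : \sum_z mu z = 1 ->
  Ex mu n (fun s => (count a s)%:R) = n%:R * \sum_(z | a z) mu z.
Proof.
move=> mu1; elim: n => [|n IH] /=; first by rewrite mul0r.
transitivity (\sum_z (mu z * (a z)%:R + mu z * (n%:R * \sum_(z | a z) mu z))).
  apply: eq_bigr => z _; rewrite -mulrDr -IH; congr (_ * _).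
  transitivity (Ex mu n (fun s => (a z)%:R + (count a s)%:R)).
    by apply: eq_Ex => s _; rewrite natrD.
  by rewrite ExD Ex_cst mu1 expr1n mul1r.
rewrite big_split /= -mulr_suml mu1 mul1r -natr1 mulrDl mul1r addrC.
by congr (_ + _); rewrite [RHS]big_mkcond; apply: eq_bigr => z _; case: (a z);
  rewrite ?mulr1 ?mulr0.
Qed.

(** Jensen's inequality for the square, from the nonnegativity of the variance. *)
Lemma sqr_Ex_le (Z : finType) (mu : Z -> R) n f :
  (forall z, 0 <= mu z) -> \sum_z mu z = 1 ->
  Ex mu n f ^+ 2 <= Ex mu n (fun s => f s ^+ 2).
Proof.
move=> mu0 mu1; set e := Ex mu n f.
have : 0 <= Ex mu n (fun s => (f s - e) ^+ 2).
  by apply: Ex_ge0 => // s; exact: sqr_ge0.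
rewrite (@eq_Ex _ _ _ _ (fun s => f s ^+ 2 + (- (2 * e) * f s + e ^+ 2))).
  rewrite !ExD ExM Ex_cst mu1 expr1n mul1r -/e; lra.
by move=> s _; ring.
Qed.

(** Conditioning on the number [m] of entries other than [None]: these keep their order and carry
    the unnormalised masses [mu \o Some]. The induction step is Pascal's rule. *)
Lemma Ex_pmap (Z : finType) (mu : option Z -> R) n f :
  Ex mu n (fun s => f (pmap id s)) =
  \sum_(m < n.+1) 'C(n, m)%:R * mu None ^+ (n - m) * Ex (mu \o Some) m f.
Proof.
elim: n f => [|n IH] f.
  by rewrite big_ord_recl big_ord0 /= addr0 !mul1r.
rewrite /= (bigD1 None) //= IH.
have -> : \sum_(z | z != None) mu z * Ex mu n (fun s => f (pmap id (z :: s))) =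
    \sum_(m < n.+1) 'C(n, m)%:R * mu None ^+ (n - m) * Ex (mu \o Some) m.+1 f.
  under [RHS]eq_bigr => m _ do rewrite /= mulr_sumr.
  rewrite [RHS]exchange_big /=.
  rewrite (reindex_omap (fun z : Z => Some z) id) /=; last by case.
  under eq_bigl => z do rewrite eqxx.
  apply: eq_bigr => z _; rewrite (IH (fun s => f (z :: s))) mulr_sumr.
  by apply: eq_bigr => m _; rewrite mulrCA.
rewrite [RHS]big_ord_recl [X in mu None * X]big_ord_recl /= !bin0 !subn0 mulrDr -addrA.
congr (_ + _); first by rewrite !mul1r exprS mulrA.
under [RHS]eq_bigr => m _ do rewrite /bump /= add1n binS natrD mulrDl mulrDl subSS.
rewrite big_split /= [X in _ = X + _]big_ord_recr /= bin_small //.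
rewrite !mul0r addr0; congr (_ + _).
rewrite mulr_sumr; apply: eq_bigr => m _ /=.
rewrite /bump /= add1n -(subnSK (ltn_ord m)) exprS; ring.
Qed.

(** A fixed mask cuts a product sample into two independent product samples. *)
Lemma Ex_mask (Z : finType) (mu : Z -> R) (b : bitseq) (F : seq Z -> seq Z -> R) :
  Ex mu (size b) (fun s => F (mask b s) (mask (map negb b) s)) =
  Ex mu (count id b) (fun x => Ex mu (count negb b) (fun y => F x y)).
Proof.
elim: b F => [|[] b IH] F //=.
  by apply: eq_bigr => z _; rewrite (IH (fun x y => F (z :: x) y)).
rewrite Ex_sum; apply: eq_bigr => z _.
by rewrite (IH (fun x y => F x (z :: y))).
Qed.

End IteratedSums.

(** * Random bridges *)

(* The walk with steps +1 for [true] and -1 for [false] reaches height [h]. *)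
Fixpoint hits (h : nat) (b : bitseq) : bool :=
  if h is h'.+1 then
    if b is x :: b' then (if x then hits h' b' else hits h.+1 b') else false
  else true.

Lemma hits0 b : hits 0 b.
Proof. by case: b. Qed.

(** Steps have size one, so a walk at or above [h] after [k] steps has passed through [h]. *)
Lemma hits_prefix h b k :
  (count negb (take k b) + h <= count id (take k b))%N -> hits h b.
Proof.
elim: b k h => [|x b IH] k [|h] //=; case: k => [|k] //=.
by case: x => /= H; apply: (IH k); lia.
Qed.

Section Bridge.
Context {R : realFieldType}.

Definition bit_sum n (f : bitseq -> R) : R := @Ex R bool (fun=> 1) n f.

Lemma bit_sumS n f : bit_sum n.+1 f =
  bit_sum n (fun b => f (true :: b)) + bit_sum n (fun b => f (false :: b)).
Proof. by rewrite /bit_sum /= big_bool !mul1r. Qed.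

Lemma eq_bit_sum n f g : (forall b, size b = n -> f b = g b) ->
  bit_sum n f = bit_sum n g.
Proof. exact: eq_Ex. Qed.

Lemma bit_sum0 n f : (forall b, size b = n -> f b = 0) -> bit_sum n f = 0.
Proof. by move=> f0; rewrite (eq_bit_sum f0) /bit_sum Ex_cst mulr0. Qed.

Lemma bit_sum_count n a : bit_sum n (fun b => (count id b == a)%:R) = 'C(n, a)%:R.
Proof.
elim: n a => [|n IH] a; first by rewrite /bit_sum /=; case: a.
rewrite bit_sumS; case: a => [|a].
  rewrite (@bit_sum0 _ (fun b => _)) ?add0r => [|b _ //].
  by under eq_bit_sum => b _ do rewrite /= add0n; rewrite IH !bin0.
rewrite binS natrD addrC -!IH; congr (_ + _).
Qed.

(* The reflection principle: the right-hand side obeys the first-step recurrence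
   of the left-hand side, which is Pascal's rule. *)
Lemma bit_sum_hits n a b h : (a + b = n)%N -> (a <= b + h)%N ->
  bit_sum n (fun c => ((count id c == a) && hits h c)%:R) = 'C(n, b + h)%:R.
Proof.
elim: n a b h => [|n IH] a b h.
  move=> abn _; have [-> ->] : a = 0%N /\ b = 0%N by lia.
  by rewrite /bit_sum /=; case: h.
move=> abn abh; case: h abh => [|h] abh.
  rewrite addn0; under eq_bit_sum => c _ do rewrite hits0 andbT.
  by rewrite bit_sum_count -bin_sub; [congr ('C(_, _)%:R); lia|lia].
rewrite bit_sumS addnS binS natrD addrC; congr (_ + _).
  case: b abn abh => [|b] abn abh.
    rewrite bin_small; last lia; apply: bit_sum0 => c sc /=.
    by have := count_size id c; case: eqP => //=; lia.
  have -> : ((b.+1 + h).+1 = b + h.+2)%N by lia.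
  by rewrite -(IH a b h.+2) //; lia.
case: a abn abh => [|a] abn abh.
  by rewrite bin_small; [apply: bit_sum0|lia].
rewrite -(IH a b h); [|lia|lia].
by apply: eq_bit_sum => c _.
Qed.

Lemma bit_sum_negb n f : bit_sum n (fun b => f (map negb b)) = bit_sum n f.
Proof.
elim: n f => [|n IH] f //; rewrite !bit_sumS /= addrC.
by rewrite (IH (fun b => f (true :: b))) (IH (fun b => f (false :: b))).
Qed.

Lemma bit_sum_hits_negb m h :
  bit_sum m.*2 (fun c => ((count id c == m) && hits h (map negb c))%:R) =
  'C(m.*2, m + h)%:R.
Proof.
rewrite -(@bit_sum_hits m.*2 m m h); [|lia|lia].
rewrite -[RHS]bit_sum_negb; apply: eq_bit_sum => c sc.
have := count_predC id c; rewrite sc count_map.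
have -> : count (predC id) c = count (preim negb id) c by [].
by move=> H; congr ((_ && _)%:R); apply/eqP/eqP; lia.
Qed.

End Bridge.

(** * Central binomial sums, and the discrepancy of two halves of a sorted sample *)

Lemma sum_mul_bin_central m :
  (\sum_(h < m) (h.+1.*2 * 'C(m.*2, m + h.+1)) = m * 'C(m.*2, m))%N.
Proof.
case: m => [|m]; first by rewrite big_ord0.
(* The antidifference of the summand: with [M = m + 1], [2h 'C(2M, M + h) = 2M ('C(2M - 1, M + h -
   1) - 'C(2M - 1, M + h))]. *)
pose c k := (m.+1.*2 * 'C(m.*2.+1, m.+1 + k))%N.
have key h : (h.+1.*2 * 'C(m.+1.*2, m.+1 + h.+1) + c h.+1 = c h)%N.
  rewrite /c !doubleS addnS (binS m.*2.+1).
  have := mul_bin_left m.*2.+1 (m.+1 + h).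
  have [hm|hm] := leqP h m.
    have -> : (m.*2.+1 - (m.+1 + h) = m - h)%N by lia.
    move: ('C(_, (m.+1 + h).+1)) ('C(_, m.+1 + h)) => x y; nia.
  by rewrite !(@bin_small m.*2.+1) ?muln0 ?addn0 ?muln0 //; lia.
have -> : (m.+1 * 'C(m.+1.*2, m.+1) = c 0)%N.
  rewrite /c addn0 !doubleS (binS m.*2.+1).
  have -> : 'C(m.*2.+1, m) = 'C(m.*2.+1, m.+1).
    by rewrite -(@bin_sub _ m); [congr ('C(_, _)); lia|lia].
  by rewrite mulnDr; lia.
have H k : (\sum_(h < k) h.+1.*2 * 'C(m.+1.*2, m.+1 + h.+1) + c k = c 0)%N.
  by elim: k => [|k IH]; rewrite ?big_ord0 // big_ord_recr /= -addnA key.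
have cm : c m.+1 = 0%N by rewrite /c bin_small ?muln0 //; lia.
by have := H m.+1; rewrite cm addn0.
Qed.

(** Writing [2h + 1 = 2(h + 1) - 1] gives twice the telescoping sum minus twice a sum of binomials.
    Of the latter only the first, ['C(2m, m + 1) = m / (m + 1) * 'C(2m, m)], is kept; it produces
    the factor [m + 1]. *)
Lemma sum_odd_bin_central m : (0 < m)%N ->
  (m.+1 * \sum_(h < m) (h.*2.+1 * ('C(m.*2, m + h.+1)).*2) <=
   (m ^ 2).*2 * 'C(m.*2, m))%N.
Proof.
case: m => // m _.
have E := sum_mul_bin_central m.+1.
have E2 : (m.+2 * 'C(m.+1.*2, m.+1 + 1) = m.+1 * 'C(m.+1.*2, m.+1))%N.
  by have := mul_bin_left m.+1.*2 m.+1; rewrite addn1; nia.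
have E1 : (\sum_(h < m.+1) (h.*2.+1 * ('C(m.+1.*2, m.+1 + h.+1)).*2) +
    \sum_(h < m.+1) ('C(m.+1.*2, m.+1 + h.+1)).*2 =
    (\sum_(h < m.+1) (h.+1.*2 * 'C(m.+1.*2, m.+1 + h.+1))).*2)%N.
  rewrite -big_split -[RHS]mul2n big_distrr; apply: eq_bigr => h _ /=; nia.
rewrite E [X in (_ + X)%N]big_ord_recl /= in E1.
move: E1; set A := \sum_(h < m.+1) _; set B := \sum_(h < m) _.
move=> E1; nia.
Qed.

(** In a sorted sequence a downward closed predicate holds exactly on an initial segment, of length
    [k]. A threshold thus becomes a time of the walk [b]. *)
Lemma count_mask_sorted (Z : eqType) (le : rel Z) (a : pred Z) (s : seq Z) :
  transitive le -> (forall x y, le x y -> a y -> a x) -> sorted le s ->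
  exists k, forall b, size b = size s ->
    count a (mask b s) = count id (take k b).
Proof.
move=> le_trans ale; elim: s => [|x s IH] /= ss.
  by exists 0%N => b; rewrite mask0 take0.
have [k kP] := IH (path_sorted ss).
have [ax|ax] := boolP (a x).
  exists k.+1 => -[|y b] //= [sb].
  by case: y => /=; rewrite ?ax kP.
exists 0%N => b _; rewrite take0; apply/eqP; rewrite eqn0Ngt -has_count.
apply/hasPn => y /mem_mask; rewrite inE => /predU1P[-> //|ys].
apply: contra ax => ay; apply: ale ay.
by have /allP/(_ _ ys) := order_path_min le_trans ss.
Qed.

(** A square as a sum of odd numbers, which turns tail bounds into a second moment. *)
Lemma sum_odd_ltn d m : (d <= m)%N -> (\sum_(h < m) h.*2.+1 * (h < d) = d ^ 2)%N.
Proof.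
elim: m => [|m IH]; first by rewrite leqn0 => /eqP ->; rewrite big_ord0.
rewrite big_ord_recr leq_eqVlt /= => /predU1P[->|].
  rewrite ltnSn muln1.
  have -> : (\sum_(i < m) i.*2.+1 * (i < m.+1) = \sum_(i < m) i.*2.+1 * (i < m))%N.
    by apply: eq_bigr => i _; rewrite ltn_ord ltnS ltnW ?ltn_ord.
  have -> : (\sum_(i < m) i.*2.+1 * (i < m) = m ^ 2)%N.
    by elim: m {IH} => [|m IH]; rewrite ?big_ord0 // big_ord_recr /= ltnSn;
      under eq_bigr => i _ do (rewrite leqW ?ltn_ord // -(ltn_ord i)); rewrite IH; lia.
  by rewrite -!mulnn; lia.
by rewrite ltnS => dm; rewrite IH // ltnNge dm muln0 addn0.
Qed.

Definition count_le r (t : nat) (s : seq 'I_r) : nat :=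
  count (fun c : 'I_r => c <= t)%N s.

(* The [maxn] of the two truncated differences is their distance. *)
Definition disc r (x y : seq 'I_r) : nat :=
  \max_(t < r) maxn (count_le t x - count_le t y) (count_le t y - count_le t x).

(** On a sorted pooled sample, the difference of the two counts at a threshold is the height of the
    bridge [b] at some time. A discrepancy above [h] therefore makes [b] or its negation reach
    [h + 1]. *)
Lemma disc_sorted_le r (s : seq 'I_r) (b : bitseq) m :
  sorted (fun x y : 'I_r => x <= y)%N s -> size s = m.*2 -> size b = m.*2 ->
  count id b = m ->
  (disc (mask b s) (mask (map negb b) s) ^ 2 <=
   \sum_(h < m) h.*2.+1 * (hits h.+1 b + hits h.+1 (map negb b)))%N.
Proof.
move=> ss sz sb cb.
have cb' : count id (map negb b) = m.
  have := count_predC id b; rewrite sb count_map.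
  have -> : count (predC id) b = count (preim negb id) b by [].
  by lia.
(* Each half has [m] points, so the discrepancy is at most [m] and the layers [h < m] suffice. *)
rewrite -(@sum_odd_ltn _ m); last first.
  apply/bigmax_leqP => t _.
  have := count_size (fun c : 'I_r => c <= t)%N (mask b s).
  have := count_size (fun c : 'I_r => c <= t)%N (mask (map negb b) s).
  rewrite /count_le !size_mask ?size_map; lia.
apply: leq_sum => h _; rewrite leq_mul2l /=.
case: (ltnP h (disc _ _)) => // hd.
suff : hits h.+1 b || hits h.+1 (map negb b) by case: hits => //; case: hits.
apply: contraLR hd => /norP[/negP n1 /negP n2]; rewrite -leqNgt.
apply/bigmax_leqP => t _.
have [k kP] := @count_mask_sorted _ (fun x y : 'I_r => x <= y)%N
  (fun c : 'I_r => c <= t)%N s (fun y x z => @leq_trans y x z)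
  (fun x y => @leq_trans y x t) ss.
rewrite /count_le !kP ?size_map ?sb //.
rewrite leqNgt; apply/negP => H.
have E : count negb (take k b) = count id (take k (map negb b)).
  by rewrite -map_take count_map.
have E' : count negb (take k (map negb b)) = count id (take k b).
  by rewrite -map_take count_map; apply: eq_count => x /=; rewrite negbK.
move: H; rewrite leq_max => /orP[] H.
  by apply: n1; apply: (@hits_prefix _ _ k); lia.
by apply: n2; apply: (@hits_prefix _ _ k); lia.
Qed.

Lemma count_mask_tnth n (Z : Type) (a : pred Z) (s : n.-tuple Z) (b : n.-tuple bool) :
  count a (mask b s) = (\sum_(i < n) (tnth b i && a (tnth s i)))%N.
Proof.
elim: n s b => [|n IH] s b; first by rewrite big_ord0 [s]tuple0 mask0.
case/tupleP: s => x s; case/tupleP: b => y b.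
rewrite big_ord_recl !tnth0 /=.
under eq_bigr => i _ do rewrite !tnthS.
by rewrite -IH; case: y.
Qed.

(** * Second moment of the two-sample discrepancy *)

Section SecondMoment.
Context {R : realFieldType}.

(** The total over all splits of [2m] pooled points into halves of size [m], not yet divided by the
    number ['C(2m, m)] of splits. *)
Definition disc2_bridge r m (s : seq 'I_r) : R :=
  bit_sum m.*2 (fun b => (count id b == m)%:R *
                    (disc (mask b s) (mask (map negb b) s) ^ 2)%:R).

(** Moving the bits of each mask along with the points leaves all counts unchanged and only permutes
    the masks. This allows the pooled sample to be sorted. *)
Lemma disc2_bridge_perm r m (s s' : seq 'I_r) : size s = m.*2 ->
  perm_eq s s' -> disc2_bridge m s = disc2_bridge m s'.
Proof.
move=> /eqP sz ss'; have sz' : size s' == m.*2 by rewrite -(perm_size ss').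
pose t := Tuple sz; pose t' := Tuple sz'.
have [/= p tp] : exists p : 'S_m.*2, t = [tuple tnth t' (p i) | i < m.*2].
  by have /tuple_permP[p E] : perm_eq t t' by []; exists p; apply: val_inj.
rewrite /disc2_bridge /bit_sum !Ex_tuple.
under eq_bigr => v _ do rewrite big1 // mul1r.
under [RHS]eq_bigr => v _ do rewrite big1 // mul1r.
rewrite (reindex (fun v : m.*2.-tuple bool =>
  [tuple tnth v (p i) | i < m.*2])) /=; last first.
  exists (fun v : m.*2.-tuple bool => [tuple tnth v ((p^-1)%g i) | i < m.*2]) => v _;
    by apply: eq_from_tnth => i; rewrite !tnth_mktuple ?permK ?permKV.
have cp a (v : m.*2.-tuple bool) :
    count a (mask [tuple tnth v (p i) | i < m.*2] s) = count a (mask v s').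
  rewrite -[s]/(val t) -[s']/(val t') !count_mask_tnth.
  rewrite [RHS](reindex_inj (@perm_inj _ p)) /=; apply: eq_bigr => i _.
  by rewrite tp !tnth_mktuple.
have cn (v : m.*2.-tuple bool) : map negb [tuple tnth v (p i) | i < m.*2] =
    [tuple tnth [tuple of map negb v] (p i) | i < m.*2].
  by rewrite -map_comp; apply: eq_map => i /=; rewrite tnth_map.
have cid (v : m.*2.-tuple bool) : count id [tuple tnth v (p i) | i < m.*2] = count id v.
  have sE : size s = m.*2 by apply/eqP.
  have sE' : size s' = m.*2 by apply/eqP.
  (* The number of bits set is the size of the selected part, to which [cp] applies with the full
     predicate. *)
  rewrite -(@size_mask _ _ s) ?size_tuple // -count_predT cp count_predT.
  by rewrite size_mask ?size_tuple.
apply: eq_bigr => v _.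
rewrite cid; congr (_ * (_ ^ 2)%:R); apply: eq_bigr => k _.
by rewrite /count_le !cp cn !cp.
Qed.

Lemma disc2_bridge_le r m (s : seq 'I_r) : (0 < m)%N -> size s = m.*2 ->
  m.+1%:R * disc2_bridge m s <= ((m ^ 2).*2 * 'C(m.*2, m))%:R.
Proof.
move=> m0 sz; pose le := (fun x y : 'I_r => x <= y)%N.
rewrite (@disc2_bridge_perm _ _ _ (sort le s)) //; last by rewrite perm_sym perm_sort.
have sss : sorted le (sort le s) by apply: sort_sorted => x y; apply: leq_total.
apply: le_trans (_ : (m.+1 * \sum_(h < m) (h.*2.+1 * ('C(m.*2, m + h.+1)).*2))%:R <= _).
  rewrite natrM ler_pM2l ?ltr0n //.
  apply: (@le_trans _ _ (bit_sum m.*2 (fun b => \sum_(h < m) h.*2.+1%:R *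
      (((count id b == m) && hits h.+1 b)%:R +
       ((count id b == m) && hits h.+1 (map negb b))%:R)))).
    apply: le_Ex => // b sb; case: eqP => [cb|_]; last first.
      by rewrite mul0r big1 // => h _; rewrite addr0 mulr0.
    rewrite mul1r /=.
    apply: (@le_trans _ _ (\sum_(h < m) h.*2.+1 *
      (hits h.+1 b + hits h.+1 (map negb b)))%:R).
      by rewrite ler_nat; apply: disc_sorted_le => //; rewrite size_sort.
    by rewrite natr_sum; apply: ler_sum => h _; rewrite natrM natrD.
  rewrite /bit_sum Ex_sum natr_sum; apply: ler_sum => h _.
  rewrite natrM ExD -/(bit_sum _ _) -/(bit_sum _ _) bit_sum_hits_negb.
  rewrite (@bit_sum_hits _ _ m m); [|lia|lia].
  by rewrite -natrD addnn.
by rewrite ler_nat sum_odd_bin_central.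
Qed.

Lemma Ex_disc_le r m (mu : 'I_r -> R) : (0 < m)%N ->
  (forall z, 0 <= mu z) -> \sum_z mu z = 1 ->
  Ex mu m (fun x => Ex mu m (fun y => (disc x y ^ 2)%:R)) <= (m ^ 2)%:R * 2 / m.+1%:R.
Proof.
move=> m0 mu0 mu1; set e := Ex _ _ _.
have C0 : 0 < 'C(m.*2, m)%:R :> R by rewrite ltr0n bin_gt0; lia.
(* Exchangeability: each of the ['C(2m, m)] masks splits a pooled sample into two independent
   samples of size [m], and so contributes [e]. *)
have Ce : 'C(m.*2, m)%:R * e = Ex mu m.*2 (disc2_bridge m).
  rewrite /disc2_bridge Ex_exchange -(bit_sum_count m.*2 m) [LHS]mulrC -ExM.
  apply: eq_bit_sum => b sb; rewrite ExM mulrC; case: eqP => cb; last by rewrite !mul0r.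
  rewrite !mul1r -sb (Ex_mask mu b (fun x y => (disc x y ^ 2)%:R)) cb.
  suff -> : count negb b = m by [].
  have := count_predC id b; rewrite sb cb.
  by have -> : count (predC id) b = count negb b by []; lia.
rewrite ler_pdivlMr ?ltr0n // -(ler_pM2l C0) mulrA Ce.
apply: (@le_trans _ _ (Ex mu m.*2 (fun=> ((m ^ 2).*2 * 'C(m.*2, m))%:R))).
  rewrite mulrC -ExM; apply: le_Ex => // s sz; exact: disc2_bridge_le.
rewrite Ex_cst mu1 expr1n mul1r natrM -muln2 natrM; lra.
Qed.

End SecondMoment.

(** * Deviation of empirical distribution functions *)

Section Deviation.
Context {R : rcfType}.

Definition sup_dev r (mu : 'I_r -> R) (s : seq 'I_r) : R :=
  \big[Num.max/0]_(t < r)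
    `|(count_le t s)%:R / (size s)%:R
      - \sum_(c < r | (c <= t)%N) mu c|.

Lemma sup_dev_ge0 r (mu : 'I_r -> R) s : 0 <= sup_dev mu s.
Proof. by apply: (big_ind (fun x => 0 <= x)) => // x y x0 y0; rewrite le_max x0. Qed.

(** For the empty sample the convention 0/0 = 0 makes the empirical cdf vanish, and the deviation is
    the true cdf. *)
Lemma sup_dev_nil_le1 r (mu : 'I_r -> R) : (forall z, 0 <= mu z) -> \sum_z mu z = 1 ->
  sup_dev mu [::] <= 1.
Proof.
move=> mu0 mu1; apply: (big_ind (fun x => x <= 1)) => // [x y x1 y1|t _].
  by rewrite ge_max x1.
rewrite mul0r sub0r normrN ger0_norm ?sumr_ge0 // -mu1.
by rewrite [leRHS](bigID (fun c : 'I_r => c <= t)%N) /= lerDl sumr_ge0.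
Qed.

(* Jensen's inequality against a ghost sample [y] removes the unknown mean. *)
Lemma sup_dev_sqr_le r (mu : 'I_r -> R) m s : (forall z, 0 <= mu z) ->
  \sum_z mu z = 1 -> (0 < m)%N -> size s = m ->
  sup_dev mu s ^+ 2 <= m%:R ^- 2 * Ex mu m (fun y => (disc s y ^ 2)%:R).
Proof.
move=> mu0 mu1 m0 sz; have mR : m%:R != 0 :> R by rewrite pnatr_eq0 -lt0n.
rewrite -ExM; set B := Ex _ _ _.
have B0 : 0 <= B.
  by apply: Ex_ge0 => // y; apply: mulr_ge0; rewrite ?invr_ge0 ?exprn_ge0.
apply: (big_ind (fun x => x ^+ 2 <= B)) => [|x y xB yB|t _].
- by rewrite expr0n.
- by rewrite maxEle; case: ifP.
rewrite real_normK ?num_real // sz /count_le.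
pose a := fun c : 'I_r => (c <= t)%N.
have -> : (count a s)%:R / m%:R - \sum_(c < r | a c) mu c =
    Ex mu m (fun y => m%:R^-1 * ((count a s)%:R + (-1) * (count a y)%:R)).
  rewrite ExM ExD ExM Ex_cst mu1 expr1n mul1r Ex_count //.
  by field.
apply: le_trans (sqr_Ex_le _ _ mu0 mu1) _; apply: le_Ex => // y _.
rewrite exprMn -exprVn ler_wpM2l ?exprn_ge0 ?invr_ge0 //.
have : (maxn (count a s - count a y) (count a y - count a s) <= disc s y)%N.
  exact: (leq_bigmax (F := fun u : 'I_r =>
    maxn (count_le u s - count_le u y) (count_le u y - count_le u s)) t).
set x := count a s; set z := count a y => H.
apply: (@le_trans _ _ ((maxn (x - z) (z - x)) ^ 2)%:R); last by rewrite ler_nat leq_sqr.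
rewrite natrX mulN1r; case: (leqP x z) => xz.
  have -> : maxn (x - z) (z - x) = (z - x)%N by lia.
  by rewrite natrB // -sqrrN opprB.
have -> : maxn (x - z) (z - x) = (x - z)%N by lia.
by rewrite natrB // ltnW.
Qed.

Lemma Ex_sup_dev_sqr_le r (mu : 'I_r -> R) m : (forall z, 0 <= mu z) ->
  \sum_z mu z = 1 -> (0 < m)%N ->
  Ex mu m (fun s => sup_dev mu s ^+ 2) <= 2 / m.+1%:R.
Proof.
move=> mu0 mu1 m0; have mR : m%:R != 0 :> R by rewrite pnatr_eq0 -lt0n.
apply: (@le_trans _ _
  (Ex mu m (fun s => m%:R ^- 2 * Ex mu m (fun y => (disc s y ^ 2)%:R)))).
  by apply: le_Ex => // s sz; apply: sup_dev_sqr_le.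
rewrite ExM; have := Ex_disc_le m0 mu0 mu1; rewrite natrX => H.
apply: le_trans (ler_wpM2l _ H) _; first by rewrite invr_ge0 exprn_ge0.
have : m.+1%:R != 0 :> R by rewrite pnatr_eq0.
move: m.+1%:R => k k0.
by rewrite le_eqVlt; apply/orP; left; apply/eqP; field; rewrite mR k0.
Qed.

(** The mean of [1 / (N + 1)] for binomial [N]. Since ['C(n, m) / (m + 1) = 'C(n + 1, m + 1) / (n +
    1)], the sum is part of the expansion of [(q + p) ^ (n + 1) = 1], lacking one nonnegative
    term. *)
Lemma sum_binom_inv_le n (p q : R) : 0 < p -> 0 <= q -> p + q = 1 ->
  \sum_(m < n.+1) 'C(n, m)%:R * q ^+ (n - m) * p ^+ m / m.+1%:R <= (n.+1%:R * p)^-1.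
Proof.
move=> p0 q0 pq.
have -> : \sum_(m < n.+1) 'C(n, m)%:R * q ^+ (n - m) * p ^+ m / m.+1%:R =
    (n.+1%:R * p)^-1 * \sum_(m < n.+1) 'C(n.+1, m.+1)%:R * q ^+ (n - m) * p ^+ m.+1.
  rewrite mulr_sumr; apply: eq_bigr => m _.
  have : m.+1%:R * 'C(n.+1, m.+1)%:R = n.+1%:R * 'C(n, m)%:R :> R.
    by rewrite -!natrM mul_bin_diag.
  move=> E; have mR : m.+1%:R != 0 :> R by rewrite pnatr_eq0.
  have nR : n.+1%:R != 0 :> R by rewrite pnatr_eq0.
  have -> : 'C(n, m)%:R = n.+1%:R^-1 * (m.+1%:R * 'C(n.+1, m.+1)%:R) :> R.
    by rewrite E mulKf.
  move: m.+1%:R n.+1%:R mR nR {E} => k l k0 l0.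
  by rewrite exprS; field; rewrite k0 l0 gt_eqF.
rewrite ler_piMr ?invr_ge0 ?mulr_ge0 ?ler0n ?(ltW p0) //.
have : (q + p) ^+ n.+1 = 1 by rewrite addrC pq expr1n.
rewrite exprDn big_ord_recl /= => H.
rewrite -[leRHS]H -[leLHS]add0r lerD //.
  by rewrite mulrn_wge0 // mulr_ge0 ?exprn_ge0 // ltW.
rewrite ler_sum // => m _; rewrite /bump /= add1n subSS -mulr_natl; lra.
Qed.

(** [None] stands for an observation with another label, so the effective sample size is binomial;
    division by [1 - mu None] gives the conditional law of the others. *)
Lemma Ex_sup_dev_le r (mu : option 'I_r -> R) n : (forall z, 0 <= mu z) ->
  \sum_z mu z = 1 -> mu None < 1 ->
  Ex mu n (fun v => sup_dev (fun c => mu (Some c) / (1 - mu None)) (pmap id v)) <=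
  mu None ^+ n + Num.sqrt (2 / (n.+1%:R * (1 - mu None))).
Proof.
move=> mu0 mu1 q1; set q := mu None; set p := 1 - q.
have p0 : 0 < p by rewrite subr_gt0.
have sp : \sum_c mu (Some c) = p.
  rewrite /p -mu1 (bigD1 None) //= addrAC subrr add0r.
  rewrite [RHS](reindex_omap (fun z : 'I_r => Some z) id) /=; last by case.
  by apply: eq_bigl => z; rewrite eqxx.
pose nu c := mu (Some c) / p.
have nu0 c : 0 <= nu c by rewrite divr_ge0 // ltW.
have nu1 : \sum_c nu c = 1 by rewrite -mulr_suml sp divff ?gt_eqF.
(* [V] bounds the mean of [2 / (N + 1)], hence the averaged second moment. *)
set V := 2 / _; have V0 : 0 < V by rewrite divr_gt0 ?mulr_gt0 ?ltr0n.
set c := Num.sqrt V; have c0 : 0 < c by rewrite sqrtr_gt0.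
have c2 : c ^+ 2 = V by rewrite sqr_sqrtr // ltW.
rewrite Ex_pmap.
have Emu m f : Ex (mu \o Some) m f = p ^+ m * Ex nu m f.
  rewrite -Ex_scale; elim: m f => [|m IH] f //=; apply: eq_bigr => z _.
  by rewrite IH /nu mulrCA divff ?mulr1 // gt_eqF.
under eq_bigr => m _ do rewrite Emu mulrA.
set E := Ex nu.
rewrite big_ord_recl /= bin0 mul1r expr0 mulr1 subn0 lerD //.
  by rewrite ler_piMr ?exprn_ge0 //; apply: sup_dev_nil_le1.
pose W m := 'C(n, m)%:R * q ^+ (n - m) * p ^+ m.
have W0 m : 0 <= W m by rewrite /W !mulr_ge0 ?exprn_ge0 ?(ltW p0) //; apply: mu0.
(* The term [m = 0] is put back so that the weights [W m] sum to 1; the two parts then add up to at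
   most [c / 2 + c / 2]. *)
apply: (@le_trans _ _ (\sum_(m < n.+1) W m * (c^-1 / m.+1%:R + c / 2))); last first.
  under eq_bigr => m _ do rewrite mulrDr.
  rewrite big_split /= -mulr_suml.
  have -> : \sum_(m < n.+1) W m = 1.
    transitivity ((q + p) ^+ n); last by rewrite addrC subrK expr1n.
    by rewrite exprDn; apply: eq_bigr => m _; rewrite -mulr_natl mulrA.
  have := @sum_binom_inv_le n p q p0 (mu0 _) (subrK _ _) => H.
  have -> : \sum_(m < n.+1) W m * (c^-1 / m.+1%:R) =
      c^-1 * \sum_(m < n.+1) W m / m.+1%:R.
    by rewrite mulr_sumr; apply: eq_bigr => m _; rewrite mulrCA.
  have : c^-1 * \sum_(m < n.+1) W m / m.+1%:R <= c^-1 * (V / 2).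
    apply: ler_wpM2l; first by rewrite invr_ge0 ltW.
    by apply: le_trans H _; rewrite /V mulrAC divff ?mul1r ?pnatr_eq0 //.
  have -> : c^-1 * (V / 2) = c / 2 by rewrite -c2 expr2; field; rewrite gt_eqF.
  lra.
rewrite [leRHS]big_ord_recl /= -[leLHS]add0r lerD //.
  by apply: mulr_ge0 => //; rewrite addr_ge0 ?divr_ge0 ?invr_ge0 // ltW.
apply: ler_sum => m _; rewrite /bump /= add1n -/(W m.+1).
apply: (ler_wpM2l (W0 _)); rewrite /E.
(* AM-GM in place of Cauchy-Schwarz, with the optimal constant [c] *)
apply: (@le_trans _ _ (Ex nu m.+1 (fun s => (2 * c)^-1 * sup_dev nu s ^+ 2 + c / 2))).
  apply: le_Ex => // s _; set x := sup_dev nu s.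
  have : 0 <= (2 * c)^-1 * (x - c) ^+ 2.
    by rewrite mulr_ge0 ?sqr_ge0 // invr_ge0 mulr_ge0 // ltW.
  have -> : (2 * c)^-1 * (x - c) ^+ 2 = (2 * c)^-1 * x ^+ 2 + c / 2 - x.
    by field; rewrite gt_eqF.
  by rewrite subr_ge0.
rewrite ExD ExM Ex_cst nu1 expr1n mul1r lerD2r.
apply: le_trans (ler_wpM2l _ (Ex_sup_dev_sqr_le nu0 nu1 (ltn0Sn m))) _.
  by rewrite invr_ge0 mulr_ge0 // ltW.
have : m.+2%:R != 0 :> R by rewrite pnatr_eq0.
move: m.+2%:R => k k0.
by rewrite le_eqVlt; apply/orP; left; apply/eqP; field; rewrite k0 gt_eqF.
Qed.

End Deviation.

(** * Probability spaces *)

Lemma measurable_le_fun {d : measure_display} {T : measurableType d} {R : realType}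
    (W : T -> R) t :
  measurable_fun setT W -> measurable [set x | W x <= t].
Proof.
move=> mW; rewrite -[X in measurable X]setTI.
by have := mW measurableT `]-oo, t]%classic (measurable_itv _);
  rewrite /preimage; under eq_set => x do rewrite /= in_itv /=.
Qed.

Section Measure.
Context {R : realType} {d : measure_display} {T : measurableType d}
  (P : probability T R).

(** Valid for arbitrary functions, because the integral of a nonnegative function is a supremum over
    the simple functions below it. It serves for the integrand at the order statistic, whose
    measurability is not established. *)
Lemma ge0_le_integral_pointwise (f g : T -> \bar R) :
  (forall x, 0 <= f x)%E -> (forall x, f x <= g x)%E ->
  (\int[P]_x f x <= \int[P]_x g x)%E.
Proof.
move=> f0 fg; have g0 x : (0 <= g x)%E by exact: le_trans (fg x).
rewrite !ge0_integralTE //; apply: ereal_sup_le => _ [h hf <-].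
by exists h => // x; apply: le_trans (fg x).
Qed.

(** [f] lies below the pointwise limit of the [h r], to which monotone convergence applies; the
    index [r] may depend on the point. *)
Lemma integral_le_of_sup (f : T -> R) (h : nat -> T -> R) (B : R) :
  (forall r, measurable_fun setT (h r)) -> (forall r x, 0 <= h r x) ->
  (forall x r s, (r <= s)%N -> h r x <= h s x) -> (forall x, 0 <= f x) ->
  (forall x e, 0 < e -> exists r, f x <= h r x + e) ->
  (forall r, \int[P]_x (h r x)%:E <= B%:E)%E ->
  (\int[P]_x (f x)%:E <= B%:E)%E.
Proof.
move=> mh h0 hnd f0 fh hB.
pose g r x := (h r x)%:E.
have mg r : measurable_fun setT (g r) by exact/measurable_EFinP.
have g0 r x : setT x -> (0 <= g r x)%E by rewrite lee_fin.
have gnd x : setT x -> {homo g^~ x : n m / (n <= m)%N >-> (n <= m)%E}.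
  by move=> _ r s rs; rewrite lee_fin hnd.
apply: (@le_trans _ _ (\int[P]_x (limn (g ^~ x)))%E).
  apply: ge0_le_integral_pointwise => x; first by rewrite lee_fin.
  apply/lee_addgt0Pr => e e0; have [r fr] := fh x e e0.
  apply: (@le_trans _ _ (g r x + e%:E)%E); first by rewrite -EFinD lee_fin.
  rewrite leeD2r // (cvg_lim _ (ereal_nondecreasing_cvgn (gnd x I))) //.
  by apply: ereal_sup_ubound; exists r.
rewrite monotone_convergence //.
apply: lime_le.
  apply: ereal_nondecreasing_is_cvgn => r s rs; apply: ge0_le_integral => // x _.
    by rewrite lee_fin.
  by rewrite lee_fin hnd.
by apply: nearW => r; exact: hB.
Qed.

Lemma prE (A : set T) : measurable A -> (pr P A)%:E = P A.
Proof. by move=> mA; rewrite /pr fineK // fin_num_measure. Qed.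

Lemma pr_ge0 (A : set T) : 0 <= pr P A.
Proof. by rewrite /pr fine_ge0. Qed.

Lemma le_pr (A B : set T) : measurable A -> measurable B -> A `<=` B ->
  pr P A <= pr P B.
Proof. by move=> mA mB AB; rewrite -lee_fin !prE // le_measure ?inE. Qed.

Lemma pr_setC (A : set T) : measurable A -> pr P (~` A) = 1 - pr P A.
Proof.
move=> mA; apply: EFin_inj; rewrite prE; last exact: measurableC.
by rewrite probability_setC // EFinB prE.
Qed.

Section FiniteValued.
Context (V : finType) (z : T -> V).
Hypothesis mz : forall v, measurable [set x | z x = v].

Lemma measurable_fin_preimage (A : set V) : measurable [set x | A (z x)].
Proof.
have -> : [set x | A (z x)] = \bigcup_(v in A) [set x | z x = v].
  by apply/seteqP; split=> x /=; [move=> Ax; exists (z x)|case=> v Av /= ->].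
by apply: fin_bigcup_measurable.
Qed.

Lemma fin_comp_indicE (F : V -> R) x :
  F (z x) = \sum_v F v * \1_[set x | z x = v] x.
Proof.
rewrite (bigD1 (z x)) //= indicE mem_set // mulr1 big1 ?addr0 // => v vz.
by rewrite indicE memNset ?mulr0 // => /= E; rewrite E eqxx in vz.
Qed.

Lemma measurable_fin_comp (F : V -> R) : measurable_fun setT (F \o z).
Proof.
rewrite (_ : _ \o _ = fun x => \sum_v F v * \1_[set x | z x = v] x); last first.
  by apply/funext => x; exact: fin_comp_indicE.
by apply: measurable_sum => v; apply: measurable_funM => //; exact: measurable_indic.
Qed.

Lemma integral_fin_comp (F : V -> R) : (forall v, 0 <= F v) ->
  (\int[P]_x (F (z x))%:E = (\sum_v pr P [set x | z x = v] * F v)%:E)%E.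
Proof.
move=> F0; under eq_integral => x _ do rewrite fin_comp_indicE -sumEFin.
have mI v : measurable_fun setT (fun x => (F v * \1_[set x | z x = v] x)%:E).
  by apply/measurable_EFinP; apply: measurable_funM => //; exact: measurable_indic.
have I0 v x : setT x -> (0 <= (F v * \1_[set x | z x = v] x)%:E)%E.
  by move=> _; rewrite lee_fin mulr_ge0.
rewrite (ge0_integral_sum P measurableT mI I0).
rewrite -sumEFin; apply: eq_bigr => v _.
under eq_integral => x _ do rewrite EFinM.
rewrite ge0_integralZl_EFin //; last exact/measurable_EFinP/measurable_indic.
by rewrite integral_indic // setIT EFinM prE // muleC.
Qed.

Lemma pr_fin_sum (A : set T) : measurable A ->
  pr P A = \sum_v pr P (A `&` [set x | z x = v]).
Proof.
move=> mA; apply: EFin_inj; rewrite prE // -sumEFin.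
rewrite -[A in LHS]setIT -integral_indic //.
rewrite (eq_integral (fun x =>
  \sum_v (\1_(A `&` [set x | z x = v]) x)%:E)%E); last first.
  move=> x _; rewrite (fin_comp_indicE (fun=> \1_A x) x) -sumEFin.
  by apply: eq_bigr => v _; rewrite indicI.
have mAv v : measurable (A `&` [set x | z x = v]) by exact: measurableI.
have mI v : measurable_fun setT (fun x => (\1_(A `&` [set x | z x = v]) x : R)%:E).
  by apply/measurable_EFinP; exact: measurable_indic.
have I0 v x : setT x -> (0 <= (\1_(A `&` [set x | z x = v]) x : R)%:E)%E.
  by move=> _; rewrite lee_fin.
rewrite (ge0_integral_sum P measurableT mI I0).
by apply: eq_bigr => v _; rewrite integral_indic // setIT prE.
Qed.

End FiniteValued.

(** Continuity from above along the decreasing events [G k]. *)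
Lemma pr_right_continuous (W : T -> R) (E : set T) (q e : R) :
  measurable_fun setT W -> measurable E -> 0 < e ->
  \forall k \near \oo,
    pr P [set x | W x <= q + k.+1%:R^-1 /\ E x] <= pr P [set x | W x <= q /\ E x] + e.
Proof.
move=> mW mE e0.
have mWE t : measurable [set x | W x <= t /\ E x].
  by apply: measurableI mE; exact: measurable_le_fun.
pose G k := [set x | W x <= q + k.+1%:R^-1 /\ E x].
have capG : \bigcap_k G k = [set x | W x <= q /\ E x].
  apply/seteqP; split => [x Gx|x [Wq Ex] k _]; last first.
    by split => //; apply: le_trans Wq _; rewrite lerDl invr_ge0.
  split; last by have [] := Gx 0%N I.
  apply/ler_addgt0Pr => u u0.
  have := near_infty_natSinv_lt (PosNum u0).
  case=> N _ /(_ N (leqnn _)) /= Nu.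
  have [+ _] := Gx N I; move=> /le_trans -> //.
  by rewrite lerD2l ltW.
have Gni : {homo G : n m / (n <= m)%N >-> (m <= n)%O}.
  move=> i j ij; apply/subsetPset => x [Wx Ex]; split => //.
  apply: le_trans Wx _; rewrite lerD2l lef_pV2 ?posrE ?ltr0n //.
  by rewrite ler_nat.
have PG0 : (P (G 0%N) < +oo)%E by rewrite ltey_eq fin_num_measure //; exact: mWE.
have mG : measurable (\bigcap_k G k) by rewrite capG.
have := @nonincreasing_cvg_mu _ _ _ P G PG0 (fun k => mWE _) mG Gni.
rewrite capG => cG.
have /fine_cvg H : P (G k) @[k --> \oo] --> (pr P [set x | W x <= q /\ E x])%:E.
  by rewrite prE.
by apply: (cvgr_le _ H); rewrite ltrDl.
Qed.

End Measure.

(** * Cells cut out by finitely many thresholds *)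

Section Cells.
Context {R : realType} (G : nat -> R).

(** Counting thresholds numbers the cells of an unsorted grid; the strict inequality closes cells on
    the right, as the [<=] of a cdf requires. *)
Definition rank_below (r : nat) (s : R) : nat := (\sum_(a < r) (G a < s)%R)%N.

Lemma rank_below_le r s : (rank_below r s <= r)%N.
Proof.
rewrite -[leqRHS]card_ord -sum1_card; apply: leq_sum => a _; exact: leq_b1.
Qed.

Definition cell r s : 'I_r.+1 := inord (rank_below r s).

Lemma cellE r s : cell r s = rank_below r s :> nat.
Proof. by rewrite inordK // ltnS rank_below_le. Qed.

(** If [G t < s], all thresholds below [G t] are below [s], and [G t] itself is counted for [s]
    only. *)
Lemma cell_le r s t : (t < r)%N -> (cell r s <= cell r (G t))%N = (s <= G t).
Proof.
move=> tr; rewrite !cellE; apply/idP/idP => [|st].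
  apply: contraLR; rewrite -ltNge -ltnNge => ts.
  rewrite /rank_below (bigD1 (Ordinal tr)) //= ltxx add0n.
  rewrite [ltnRHS](bigD1 (Ordinal tr)) //= ts add1n ltnS.
  apply: leq_sum => a _; case: (ltP (G a) (G t)) => // at_.
  by rewrite (lt_trans at_ ts).
apply: leq_sum => a _; case: (ltP (G a) s) => // as_.
by rewrite (lt_le_trans as_ st).
Qed.

Lemma measurable_cell {d : measure_display} {T : measurableType d} (W : T -> R) r c :
  measurable_fun setT W -> measurable [set x | cell r (W x) = c].
Proof.
move=> mW; pose b x : {ffun 'I_r -> bool} := [ffun a : 'I_r => G a < W x].
have mb v : measurable [set x | b x = v].
  have -> : [set x | b x = v] =
      \bigcap_(a in [set: 'I_r]) [set x | (W x <= G a) = ~~ v a].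
    apply/seteqP; split => [x /= <- a _ /=|x /= H].
      by rewrite ffunE -leNgt.
    by apply/ffunP => a; have := H a I; rewrite /= ffunE leNgt => /negb_inj.
  apply: fin_bigcap_measurable => // a _; case: (v a) => /=.
    rewrite (_ : [set x | _] = ~` [set x | W x <= G a]).
      exact/measurableC/measurable_le_fun.
    by apply/seteqP; split => x /=; [move=> ->|move/negP/negbTE].
  exact: measurable_le_fun.
have := measurable_fin_preimage mb
  [set v : {ffun 'I_r -> bool} | inord (\sum_(a < r) v a)%N = c].
congr (measurable _); apply/seteqP.
by split=> x /=; under eq_bigr => a _ do rewrite ffunE.
Qed.

End Cells.

(** * Cells of the calibration sample *)

Section Sampling.
Context {R : realType} {d : measure_display} {T : measurableType d}
  (P : probability T R) {dX : measure_display} {X : measurableType dX} {K : nat}.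
Variables (S : X -> 'I_K -> R) (X0 : T -> X) (Yt : T -> 'I_K).
Variables (n : nat) (Xs : 'I_n -> T -> X) (Ys : 'I_n -> T -> 'I_K).
Hypothesis mS : forall i : 'I_K, measurable_fun setT (fun x => S x i).
Hypothesis mX0 : measurable_fun setT X0.
Hypothesis mYt : forall i : 'I_K, measurable [set w | Yt w = i].
Hypothesis Yt_gt0 : forall i : 'I_K, 0 < Pmarg P Yt i.
Hypothesis mXs : forall l : 'I_n, measurable_fun setT (Xs l).
Hypothesis mYs : forall (l : 'I_n) (i : 'I_K), measurable [set w | Ys l w = i].
Hypothesis iid : iid_pairs_as P n Xs Ys X0 Yt.

Definition Fcond (q : R) (i j : 'I_K) : R :=
  pr P [set w | S (X0 w) i <= q /\ Yt w = j] / Pmarg P Yt j.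

Let mSX i : measurable_fun setT (fun w => S (X0 w) i).
Proof. by have := measurableT_comp (mS i) mX0. Qed.

Let Yt_le1 j : Pmarg P Yt j <= 1.
Proof. by rewrite -lee_fin prE // probability_le1. Qed.

Section Grid.
Variables (G : nat -> R) (r : nat) (i j : 'I_K).

(** The law of one entry of [sample_cells]; [None] gathers the pairs whose label is not [j]. *)
Definition cell_law (o : option 'I_r.+1) : R :=
  if o is Some c then pr P [set w | cell G r (S (X0 w) i) = c /\ Yt w = j]
  else 1 - Pmarg P Yt j.

Definition sample_cell (l : 'I_n) (w : T) : option 'I_r.+1 :=
  if Ys l w == j then Some (cell G r (S (Xs l w) i)) else None.

Definition sample_cells (w : T) : n.-tuple (option 'I_r.+1) :=
  [tuple sample_cell l w | l < n].

Lemma cell_law_ge0 o : 0 <= cell_law o.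
Proof. by case: o => [c|] /=; rewrite ?pr_ge0 // subr_ge0. Qed.

Lemma cell_law_sum_le t : (t < r)%N ->
  \sum_(c < r.+1 | (c <= cell G r (G t))%N) cell_law (Some c) =
  pr P [set w | S (X0 w) i <= G t /\ Yt w = j].
Proof.
move=> tr; pose z w := cell G r (S (X0 w) i).
have mz c : measurable [set w | z w = c] by exact: (measurable_cell _ _ (mSX i)).
have mA : measurable [set w | S (X0 w) i <= G t /\ Yt w = j].
  by apply: measurableI (mYt j); exact: (measurable_le_fun _ (mSX i)).
rewrite (pr_fin_sum P mz mA).
rewrite big_mkcond; apply: eq_bigr => c _ /=; case: ifP => ct.
  congr (pr P _); apply/seteqP; split=> w /=.
    by move=> [zc Yj]; rewrite -(cell_le _ _ tr) zc.
  by move=> [[_ Yj] zc].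
rewrite (_ : _ `&` _ = set0) ?/pr ?measure0 //; apply/seteqP; split => w //=.
by move=> [[+ _] zc]; rewrite -(cell_le _ _ tr) -/(z w) zc ct.
Qed.

Lemma cell_law_sum : \sum_o cell_law o = 1.
Proof.
rewrite (bigD1 None) //= (reindex_omap (fun c : 'I_r.+1 => Some c) id) /=; last by case.
under eq_bigl => c do rewrite eqxx.
pose z w := cell G r (S (X0 w) i).
have mz c : measurable [set w | z w = c] by exact: (measurable_cell _ _ (mSX i)).
rewrite [X in 1 - X](pr_fin_sum P mz) //.
rewrite -addrA [X in 1 + X](_ : _ = 0) ?addr0 //.
apply/eqP; rewrite addrC subr_eq0; apply/eqP; apply: eq_bigr => c _.
by congr (pr P _); apply/seteqP; split => w /= [].
Qed.

(** With [B], this writes an event on the whole vector of cells as a product of one score event and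
    one label event per index, the form factored by [iid_pairs_as]. *)
Let A (v : n.-tuple (option 'I_r.+1)) (l : 'I_n) : set X :=
  [set x | if tnth v l is Some c then cell G r (S x i) = c else True].
Let B (v : n.-tuple (option 'I_r.+1)) (l : 'I_n) : set 'I_K :=
  [set y | (y == j) = isSome (tnth v l)].

Let mA v l : measurable (A v l).
Proof.
rewrite /A; case: (tnth v l) => [c|]; first exact: measurable_cell.
by rewrite (_ : [set x | True] = setT) //; apply/seteqP.
Qed.

Let sample_cells_fiber v : [set w | sample_cells w = v] =
  \bigcap_(l in [set: 'I_n]) [set w | A v l (Xs l w) /\ B v l (Ys l w)].
Proof.
apply/seteqP; split => [w /= <- l _|w /= H].
  by rewrite /A /B /= tnth_mktuple /sample_cell; case: ifP.
apply: eq_from_tnth => l; rewrite tnth_mktuple /sample_cell.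
have /= [] := H l I; rewrite /A /B /=.
by case: (tnth v l) => [c|] /= Ac ->; rewrite ?Ac.
Qed.

Lemma measurable_sample_cells v : measurable [set w | sample_cells w = v].
Proof.
rewrite sample_cells_fiber; apply: fin_bigcap_measurable => // l _.
apply: measurableI; last exact: measurable_fin_preimage.
rewrite -[X in measurable X]setTI; exact: mXs.
Qed.

Lemma pr_sample_cells v :
  pr P [set w | sample_cells w = v] = \prod_(l < n) cell_law (tnth v l).
Proof.
have [indep law] := iid.
rewrite sample_cells_fiber indep //; apply: eq_bigr => l _.
have lawj := law l _ j.
have := mA v l; rewrite /A /B; case: (tnth v l) => [c|] /= mAl.
  have /= <- := lawj [set x | cell G r (S x i) = c] mAl; congr (pr P _); apply/seteqP.
  by split=> w /= [? /eqP].
(* For [None] the label differs from [j] and the score is free: the law follows by complement. *)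
have := lawj setT measurableT.
rewrite (_ : [set w | setT (Xs l w) /\ Ys l w = j] = [set w | Ys l w = j]); last first.
  by apply/seteqP; split => w /=; [case|].
rewrite (_ : [set w | setT (X0 w) /\ Yt w = j] = [set w | Yt w = j]); last first.
  by apply/seteqP; split => w /=; [case|].
rewrite -/(Pmarg P Yt j) => <-; rewrite -pr_setC //; congr (pr P _).
by apply/seteqP; split => w /=; [case=> _ /eqP|move=> H; split => //; apply/eqP].
Qed.

Definition grid_dev (t : nat) (w : T) : R :=
  `|Fn n S Xs Ys w (G t) i j - Fcond (G t) i j|.

Definition cells_dev (t : nat) (v : seq (option 'I_r.+1)) : R :=
  `|(count_le (cell G r (G t)) (pmap id v))%:R
     / (size (pmap id v))%:R - Fcond (G t) i j|.

(** By [cell_le], the deviation at a grid threshold depends on the sample through its cells only,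
    which reduces the expectation to a finite sum. *)
Lemma grid_devE t w : (t < r)%N -> grid_dev t w = cells_dev t (sample_cells w).
Proof.
move=> tr; rewrite /grid_dev /cells_dev /Fn; congr (`|_ / _ - _|).
  rewrite -natr_sum; congr (_%:R).
  have -> : forall v : seq (option 'I_r.+1),
      count_le (cell G r (G t)) (pmap id v) =
      count (fun o : option 'I_r.+1 =>
        if o is Some c then (c <= cell G r (G t))%N else false) v.
    by elim=> [|[c|] v IH] //=; rewrite -IH.
  rewrite -sum1_count [RHS]big_mkcond big_tuple; apply: eq_bigr => l _ /=.
  rewrite tnth_mktuple /sample_cell; case: (Ys l w == j); rewrite ?andbF // andbT.
  by rewrite cell_le //; case: (_ <= _).
rewrite -natr_sum; congr (_%:R).
have -> : forall v : seq (option 'I_r.+1), size (pmap id v) = count isSome v.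
  by elim=> [|[c|] v IH] //=; rewrite IH.
rewrite -sum1_count [RHS]big_mkcond big_tuple; apply: eq_bigr => l _ /=.
by rewrite tnth_mktuple /sample_cell; case: (Ys l w == j).
Qed.

Let nu c := cell_law (Some c) / (1 - cell_law None).

Lemma cells_dev_le t v : (t < r)%N -> cells_dev t v <= sup_dev nu (pmap id v).
Proof.
move=> tr; rewrite /sup_dev.
apply: le_trans (le_bigmax _ _ (cell G r (G t))) => /=.
rewrite /nu -mulr_suml cell_law_sum_le // /cells_dev /Fcond /=.
by rewrite subKr.
Qed.

Definition max_grid_dev (w : T) : R := \big[Num.max/0]_(t < r) grid_dev t w.

Lemma max_grid_devE w :
  max_grid_dev w = \big[Num.max/0]_(t < r) cells_dev t (sample_cells w).
Proof. by apply: eq_bigr => t _; exact: grid_devE. Qed.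

Lemma measurable_max_grid_dev : measurable_fun setT max_grid_dev.
Proof.
have -> : max_grid_dev = (fun v : n.-tuple (option 'I_r.+1) =>
    \big[Num.max/0]_(t < r) cells_dev t v) \o sample_cells.
  by apply/funext => w; exact: max_grid_devE.
exact/measurable_fin_comp/measurable_sample_cells.
Qed.

Lemma max_grid_dev_ge0 w : 0 <= max_grid_dev w.
Proof. exact: bigmax_ge_id. Qed.

Lemma integral_max_grid_dev_le : (0 < n)%N ->
  (\int[P]_w (max_grid_dev w)%:E <= (bfun P Yt n j)%:E)%E.
Proof.
move=> n0; under eq_integral => w _ do rewrite max_grid_devE.
pose F (v : n.-tuple (option 'I_r.+1)) := \big[Num.max/0]_(t < r) cells_dev t v.
have F0 v : 0 <= F v by exact: bigmax_ge_id.
rewrite (integral_fin_comp P measurable_sample_cells F0) lee_fin.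
apply: (@le_trans _ _ (Ex cell_law n (fun v => sup_dev nu (pmap id v)))).
  rewrite Ex_tuple; apply: ler_sum => v _; rewrite pr_sample_cells.
  apply: ler_wpM2l; first by apply: prodr_ge0 => l _; exact: cell_law_ge0.
  apply: (big_ind (fun x => x <= sup_dev nu (pmap id v))) => //.
  - exact: sup_dev_ge0.
  - by move=> x y xs ys; rewrite ge_max xs.
  by move=> t _; exact: cells_dev_le.
have q1 : cell_law None < 1 by rewrite /= ltrBlDr ltrDl.
apply: le_trans (Ex_sup_dev_le n cell_law_ge0 cell_law_sum q1) _.
rewrite /bfun /= lerD2l subKr ler_sqrt; last first.
  by rewrite divr_ge0 ?pi_ge0 // mulr_ge0 // ltW.
(* The passage from [2 / (n + 1)] to [pi / n] under the root. *)
apply: ler_pM => //.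
- by rewrite invr_ge0 mulr_ge0 // ltW.
- exact: pi_ge2.
by rewrite lef_pV2 ?posrE ?mulr_gt0 ?ltr0n // ler_pM2r // ler_nat.
Qed.

End Grid.
End Sampling.

(** * Assembling the bound *)

(** An enumeration of the rationals; codes of no rational merely repeat the threshold 0. *)
Definition rat_grid (R : realType) (a : nat) : R :=
  if @unpickle rat a is Some q then ratr q else 0.

Section Assembly.
Context {R : realType} {d : measure_display} {T : measurableType d}
  (P : probability T R) {dX : measure_display} {X : measurableType dX} {K : nat}.
Variables (S : X -> 'I_K -> R) (X0 : T -> X) (Y Yt : T -> 'I_K).
Hypothesis mS : forall i : 'I_K, measurable_fun setT (fun x => S x i).
Hypothesis mX0 : measurable_fun setT X0.
Hypothesis mYt : forall i : 'I_K, measurable [set w | Yt w = i].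
Hypothesis Yt_gt0 : forall i : 'I_K, 0 < Pmarg P Yt i.

Let mSX i : measurable_fun setT (fun w => S (X0 w) i).
Proof. by have := measurableT_comp (mS i) mX0. Qed.

Let mSXle q i : measurable [set w | S (X0 w) i <= q].
Proof. exact: (measurable_le_fun _ (mSX i)). Qed.

Let mSL q i (L : T -> 'I_K) j : measurable [set w | L w = j] ->
  measurable [set w | S (X0 w) i <= q /\ L w = j].
Proof. by move=> mL; apply: measurableI mL; exact: mSXle. Qed.

Lemma Fcond_right_continuous q e : 0 < e ->
  \forall k \near \oo, forall ij : 'I_K * 'I_K,
    Fcond P S X0 Yt (q + k.+1%:R^-1) ij.1 ij.2 <= Fcond P S X0 Yt q ij.1 ij.2 + e.
Proof.
move=> e0; apply: filter_forall => -[i j] /=.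
have ep : 0 < e * Pmarg P Yt j by rewrite mulr_gt0.
have := pr_right_continuous P q (mSX i) (mYt j) ep.
apply: filterS => k H; rewrite /Fcond ler_pdivrMr // mulrDl divfK //.
by rewrite gt_eqF.
Qed.

Lemma le_Fcond q q' i j : q <= q' -> Fcond P S X0 Yt q i j <= Fcond P S X0 Yt q' i j.
Proof.
move=> qq; rewrite /Fcond ler_pM2r ?invr_gt0 //; apply: le_pr.
- exact: mSL.
- exact: mSL.
by move=> w [Sq Yj]; split => //; exact: le_trans qq.
Qed.

Lemma max_grid_dev_nondecreasing n (Xs : 'I_n -> T -> X) (Ys : 'I_n -> T -> 'I_K)
    (G : nat -> R) i j w r s : (r <= s)%N ->
  max_grid_dev P S X0 Yt Xs Ys G r i j w <= max_grid_dev P S X0 Yt Xs Ys G s i j w.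
Proof.
move=> rs; apply: bigmax_le => [|t _]; first exact: max_grid_dev_ge0.
exact: (le_bigmax _ (fun t : 'I_s => grid_dev P S X0 Yt Xs Ys G i j t w)
  (widen_ord rs t)).
Qed.

(** A rational [z] slightly above [q] leaves every empirical cdf unchanged, as no score lies in
    [(q, z]], and raises the true ones by at most [e]. One [z] serves all [i] and [j] since there
    are finitely many. *)
Lemma Fn_dev_le_max_grid_dev n (Xs : 'I_n -> T -> X) (Ys : 'I_n -> T -> 'I_K) w q e :
  0 < e -> exists r, forall i j,
    `|Fn n S Xs Ys w q i j - Fcond P S X0 Yt q i j| <=
    max_grid_dev P S X0 Yt Xs Ys (rat_grid R) r i j w + e.
Proof.
move=> e0.
have near_scores : \forall k \near \oo, forall li : 'I_n * 'I_K,
    q < S (Xs li.1 w) li.2 -> q + k.+1%:R^-1 < S (Xs li.1 w) li.2.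
  apply: filter_forall => -[l i] /=.
  have [qS|qS] := ltP q (S (Xs l w) i); last by apply: nearW.
  have u0 : 0 < S (Xs l w) i - q by rewrite subr_gt0.
  apply: filterS (near_infty_natSinv_lt (PosNum u0)) => k /= ku _.
  by rewrite addrC -ltrBrDr.
have [N _ /(_ N (leqnn N)) [HF HS]] :=
  filterI (Fcond_right_continuous q e0) near_scores.
have [z] := @rat_in_itvoo R q (q + N.+1%:R^-1) ltac:(by rewrite ltrDl invr_gt0).
rewrite in_itv /= => /andP[qz zN].
exists (pickle z).+1 => i j.
have Gz : rat_grid R (pickle z) = ratr z by rewrite /rat_grid pickleK.
have FnE : Fn n S Xs Ys w (ratr z) i j = Fn n S Xs Ys w q i j.
  rewrite /Fn; congr (_ / _); apply: eq_bigr => l _; congr ((_ && _)%:R).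
  apply/idP/idP => [Sz|Sq]; last exact: le_trans (ltW qz).
  rewrite leNgt; apply/negP => /(HS (l, i)) /= H.
  by have := lt_trans zN H; rewrite ltNge Sz.
have Fz : Fcond P S X0 Yt (ratr z) i j <= Fcond P S X0 Yt q i j + e.
  by apply: le_trans (HF (i, j)); apply: le_Fcond; exact: ltW.
have Fz' : Fcond P S X0 Yt q i j <= Fcond P S X0 Yt (ratr z) i j.
  by apply: le_Fcond; exact: ltW.
have : grid_dev P S X0 Yt Xs Ys (rat_grid R) i j (pickle z) w <=
    max_grid_dev P S X0 Yt Xs Ys (rat_grid R) (pickle z).+1 i j w.
  exact: (le_bigmax _ (fun t : 'I_(pickle z).+1 =>
    grid_dev P S X0 Yt Xs Ys (rat_grid R) i j t w) ord_max).
rewrite /grid_dev Gz FnE => H.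
move: Fz Fz' H; set a := Fn _ _ _ _ _ _ _ _; set c := Fcond _ _ _ _ _ _ _.
set b := Fcond _ _ _ _ _ _ _ => bc cb H.
apply: le_trans (_ : `|a - c| + e <= _); last by rewrite lerD2r.
have -> : a - b = (a - c) + (c - b) by ring.
apply: le_trans (ler_normD _ _) _; rewrite lerD2l ler_norml; lra.
Qed.

Hypothesis mY : forall i : 'I_K, measurable [set w | Y w = i].

Lemma cdf_scoreE (L : T -> 'I_K) q : (forall i, measurable [set w | L w = i]) ->
  cdf_score P S X0 L q = \sum_i pr P [set w | S (X0 w) i <= q /\ L w = i].
Proof.
move=> mL; rewrite /cdf_score.
have mA : measurable [set w | S (X0 w) (L w) <= q].
  rewrite (_ : [set w | _] =
      \bigcup_(i in [set: 'I_K]) [set w | S (X0 w) i <= q /\ L w = i]).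
    by apply: fin_bigcup_measurable => // i _; exact: mSL.
  by apply/seteqP; split => w /=; [exists (L w)|case=> i _ [Sq ->]].
rewrite (pr_fin_sum P mL mA); apply: eq_bigr => i _; congr (pr P _).
by apply/seteqP; split => w /= []; [move=> + <-|move=> + Li; rewrite Li].
Qed.

Lemma cdf_score_noisyE q :
  cdf_score P S X0 Yt q = \sum_i Pmarg P Yt i * Fcond P S X0 Yt q i i.
Proof.
rewrite cdf_scoreE //; apply: eq_bigr => i _.
by rewrite /Fcond mulrC divfK // gt_eqF.
Qed.

Hypothesis unitP : Pcond P Y Yt \in unitmx.
Hypothesis cind : cond_indep_label P X0 Y Yt.

(* Conditional independence gives F(q; i, .) = G_i *m Pcond with
   G_i l = P(S(X, i) <= q | Y = l), which the inverse of Pcond solves for G_i i. *)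
Lemma pr_clean_scoreE q i :
  pr P [set w | S (X0 w) i <= q /\ Y w = i] =
  \sum_j Pmarg P Y i * invmx (Pcond P Y Yt) j i * Fcond P S X0 Yt q i j.
Proof.
pose a l := pr P [set w | S (X0 w) i <= q /\ Y w = l] / Pmarg P Y l.
have le_PA j l : pr P [set w | S (X0 w) i <= q /\ Yt w = j /\ Y w = l] <= Pmarg P Y l.
  apply: le_pr => //; last by move=> w [_ []].
  by apply: measurableI; [exact: mSXle|apply: measurableI; [exact: mYt|exact: mY]].
have le_PA' l : pr P [set w | S (X0 w) i <= q /\ Y w = l] <= Pmarg P Y l.
  by apply: le_pr => //; [exact: mSL|move=> w []].
have Fa j : Fcond P S X0 Yt q i j = \sum_l a l * Pcond P Y Yt l j.
  have mA : measurable [set w | S (X0 w) i <= q /\ Yt w = j] by exact: mSL.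
  rewrite /Fcond (pr_fin_sum P mY mA) mulr_suml; apply: eq_bigr => l _.
  rewrite mxE /cpr mulrA; congr (_ / _).
  rewrite (_ : _ `&` _ = [set w | S (X0 w) i <= q /\ Yt w = j /\ Y w = l]); last first.
    by apply/seteqP; split => w /=; [case=> [[]]|case=> ? []].
  (* If [P(Y = l) = 0], the joint probability vanishes, and so does [a l] by the convention x/0 =
     0. *)
  have [Pl0|Pl0] := eqVneq (Pmarg P Y l) 0.
    rewrite /a Pl0 invr0 mulr0 mul0r; apply/eqP; rewrite eq_le pr_ge0 andbT.
    by rewrite -Pl0.
  have := @cind [set x | S x i <= q] l j (measurable_le_fun _ (mS i)).
  rewrite -/(Pmarg P Y l) => /(canRL (mulfK Pl0)) -> /=.
  rewrite /a [RHS]mulrAC; congr (_ * pr P _ / _).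
  by rewrite setIC.
transitivity (Pmarg P Y i * a i).
  have [Pi0|Pi0] := eqVneq (Pmarg P Y i) 0; last by rewrite /a mulrC divfK.
  rewrite Pi0 mul0r; apply/eqP; rewrite eq_le pr_ge0 andbT.
  by rewrite -Pi0.
under eq_bigr => j _ do rewrite -mulrA.
rewrite -mulr_sumr; congr (_ * _).
transitivity (\sum_l a l * (Pcond P Y Yt *m invmx (Pcond P Y Yt)) l i).
  rewrite mulmxV // (bigD1 i) //= mxE eqxx mulr1 big1 ?addr0 // => l li.
  by rewrite mxE (negbTE li) mulr0.
under [RHS]eq_bigr => j _ do rewrite Fa mulr_sumr.
rewrite exchange_big /=; apply: eq_bigr => l _; rewrite mxE mulr_sumr.
by apply: eq_bigr => j _; ring.
Qed.

Lemma cdf_score_cleanE q : cdf_score P S X0 Y q =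
  \sum_i \sum_j Pmarg P Y i * invmx (Pcond P Y Yt) j i * Fcond P S X0 Yt q i j.
Proof.
by rewrite cdf_scoreE //; apply: eq_bigr => i _; exact: pr_clean_scoreE.
Qed.

(** Both weight families of the bound in one, so that it becomes a single sum over pairs. *)
Definition weight (i j : 'I_K) : R :=
  if j == i then `|invmx (Pcond P Y Yt) i i * Pmarg P Y i - Pmarg P Yt i|
  else `|Pmarg P Y i * invmx (Pcond P Y Yt) j i|.

Lemma weight_ge0 i j : 0 <= weight i j.
Proof. by rewrite /weight; case: ifP. Qed.

Lemma BboundE n : Bbound P Y Yt n = \sum_ij weight ij.1 ij.2 * bfun P Yt n ij.2.
Proof.
rewrite -(pair_bigA _ (fun i j => weight i j * bfun P Yt n j)) /=.
apply: eq_bigr => i _; rewrite [RHS](bigD1 i) //= /weight eqxx; congr (_ + _).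
by apply: eq_bigr => j /negbTE ->.
Qed.

(** [ghat] and [gfun] are the same linear combination, of the [Fn] and of the [Fcond] respectively.
    On the diagonal the clean and noisy coefficients merge before absolute values are taken. *)
Lemma ghat_dev_le n (Xs : 'I_n -> T -> X) (Ys : 'I_n -> T -> 'I_K) w q :
  `|ghat P n S Y Yt Xs Ys w q - gfun P S X0 Y Yt q| <=
  \sum_ij weight ij.1 ij.2 *
    `|Fn n S Xs Ys w q ij.1 ij.2 - Fcond P S X0 Yt q ij.1 ij.2|.
Proof.
rewrite /ghat /gfun cdf_score_noisyE cdf_score_cleanE.
pose D i j := Fn n S Xs Ys w q i j - Fcond P S X0 Yt q i j.
pose c i j := if j == i then invmx (Pcond P Y Yt) i i * Pmarg P Y i - Pmarg P Yt i
  else Pmarg P Y i * invmx (Pcond P Y Yt) j i.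
rewrite [X in `|X|](_ : _ = \sum_i \sum_j c i j * D i j); last first.
  rewrite -!sumrB; apply: eq_bigr => i _.
  rewrite [RHS](bigD1 i) // [X in X - _ - _](bigD1 i) //.
  rewrite [X in _ - (X - _)](bigD1 i) //=.
  pose u j := Pmarg P Y i * invmx (Pcond P Y Yt) j i.
  have -> : \sum_(j < K | j != i) c i j * D i j =
      \sum_(j < K | j != i) u j * Fn n S Xs Ys w q i j -
      \sum_(j < K | j != i) u j * Fcond P S X0 Yt q i j.
    by rewrite -sumrB; apply: eq_bigr => j /negbTE ji; rewrite /c ji /D mulrBr.
  rewrite /c eqxx /D; move: (\sum_(j < K | _) _) (\sum_(j < K | _) _) => x y.
  by move: (invmx _ i i) (Fn _ _ _ _ _ _ _ _) (Fcond _ _ _ _ _ _ _) => a b z; ring.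
rewrite -(pair_bigA _ (fun i j => weight i j * `|D i j|)) /=.
apply: le_trans (ler_norm_sum _ _ _) _; apply: ler_sum => i _.
apply: le_trans (ler_norm_sum _ _ _) _; apply: ler_sum => j _.
by rewrite normrM /weight /c; case: ifP.
Qed.
End Assembly.

Unset Implicit Arguments.

Theorem theorem1 (R : realType) (d : measure_display) (T : measurableType d)
  (P : probability T R) (dX : measure_display) (X : measurableType dX)
  (K : nat) (eps : R) (S : X -> 'I_K -> R)
  (X0 : T -> X) (Y Yc : T -> 'I_K) (Bn : T -> bool)
  (n : nat) (Xs : 'I_n -> T -> X) (Ys : 'I_n -> T -> 'I_K) (k : nat) :
  (2 <= K)%N ->
  0 < eps < 1 / 2 ->
  (forall i : 'I_K, measurable_fun setT (fun x => S x i)) ->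
  measurable_fun setT X0 ->
  (forall i : 'I_K, measurable [set w | Y w = i]) ->
  (forall i : 'I_K, measurable [set w | Yc w = i]) ->
  measurable [set w | Bn w = true] ->
  pr P [set w | Bn w = true] = eps ->
  coin_indep P X0 Y Yc Bn ->
  cond_indep_label P X0 Y (noisy_label Y Yc Bn) ->
  (forall i : 'I_K, 0 < Pmarg P (noisy_label Y Yc Bn) i) ->
  Pcond P Y (noisy_label Y Yc Bn) \in unitmx ->
  (forall l : 'I_n, measurable_fun setT (Xs l)) ->
  (forall (l : 'I_n) (i : 'I_K), measurable [set w | Ys l w = i]) ->
  iid_pairs_as P n Xs Ys X0 (noisy_label Y Yc Bn) ->
  (1 <= k <= n)%N ->
  (\int[P]_w
     (`| ghat P n S Y (noisy_label Y Yc Bn) Xs Ys w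
           (order_stat (calib_scores n S Xs Ys w) k)
         - gfun P S X0 Y (noisy_label Y Yc Bn)
           (order_stat (calib_scores n S Xs Ys w) k) |)%:E
   <= (Bbound P Y (noisy_label Y Yc Bn) n)%:E)%E.
Proof.
move=> _ _ mS mX0 mY mYc mBn _ _ cind Yt0 unitP mXs mYs iid /andP[k1 kn].
have n0 : (0 < n)%N by exact: leq_trans kn.
have mYt i : measurable [set w | noisy_label Y Yc Bn w = i].
  rewrite (_ : [set w | _] = ([set w | Bn w = true] `&` [set w | Yc w = i]) `|`
      (~` [set w | Bn w = true] `&` [set w | Y w = i])).
    by apply: measurableU; apply: measurableI => //; exact: measurableC.
  apply/seteqP; split => w /=; rewrite /noisy_label; case: (Bn w) => //.
  - by left.
  - by right.
  - by case=> -[].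
  - by case=> -[].
move: (noisy_label Y Yc Bn) cind Yt0 unitP iid mYt => Yt cind Yt0 unitP iid mYt.
pose M r (ij : 'I_K * 'I_K) w :=
  max_grid_dev P S X0 Yt Xs Ys (rat_grid R) r ij.1 ij.2 w.
pose W (ij : 'I_K * 'I_K) := weight P Y Yt ij.1 ij.2.
have W0 ij : 0 <= W ij by exact: weight_ge0.
have M0 r ij w : 0 <= M r ij w by exact: max_grid_dev_ge0.
have mM r ij : measurable_fun setT (M r ij).
  exact: measurable_max_grid_dev.
have mWM r ij : measurable_fun setT (fun w => W ij * M r ij w).
  exact: measurable_funM.
(* At each outcome the order statistic is one real threshold, and the weighted grid maxima dominate
   the deviation at every threshold up to an arbitrarily small error. *)
apply: (@integral_le_of_sup _ _ _ P _ (fun r w => \sum_ij W ij * M r ij w)).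
- by move=> r; apply: measurable_sum.
- by move=> r w; apply: sumr_ge0 => ij _; exact: mulr_ge0.
- move=> w r s rs; apply: ler_sum => ij _; apply: ler_wpM2l => //.
  exact: max_grid_dev_nondecreasing.
- by [].
(* An error [e / c] in each deviation adds up to at most [e]; the summand 1 keeps [c] positive. *)
- move=> w e e0; pose c := 1 + \sum_ij W ij.
  have c0 : 0 < c by rewrite ltr_pwDl // sumr_ge0.
  have [r H] := Fn_dev_le_max_grid_dev mS mX0 mYt Yt0 Xs Ys w
    (order_stat (calib_scores n S Xs Ys w) k) (divr_gt0 e0 c0).
  exists r; apply: (le_trans (ghat_dev_le mS mX0 mYt Yt0 mY unitP cind _ _ _ _)).
  apply: (@le_trans _ _ (\sum_ij W ij * (M r ij w + e / c))).
    by apply: ler_sum => ij _; apply: ler_wpM2l; [exact: weight_ge0|exact: H].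
  under eq_bigr => ij _ do rewrite mulrDr.
  rewrite big_split /= lerD2l -mulr_suml mulrCA ler_piMr ?(ltW e0) //.
  by rewrite ler_pdivrMr // mul1r /c lerDr.
move=> r; under eq_integral => w _ do rewrite -sumEFin.
have mE ij : measurable_fun setT (fun w => (W ij * M r ij w)%:E).
  exact/measurable_EFinP.
have E0 ij w : setT w -> (0 <= (W ij * M r ij w)%:E)%E.
  by rewrite lee_fin mulr_ge0.
rewrite (ge0_integral_sum P measurableT mE E0) BboundE -sumEFin.
apply: lee_sum => ij _.
under eq_integral => w _ do rewrite EFinM.
rewrite ge0_integralZl_EFin //; last first.
- exact/measurable_EFinP.
- by move=> w _; rewrite lee_fin.
rewrite EFinM; apply: lee_wpmul2l; first by rewrite lee_fin.
exact: integral_max_grid_dev_le.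
Qed.
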